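(* Let $H$ be a hypergraph and let $A, B \subseteq E(H)$. If $B \subseteq A$, then $\tau_g(H|A) \le \tau_g(H|B)$ and $\tau_g'(H|A) \le \tau_g'(H|B)$.
   Context: A hypergraph $H=(V(H),E(H))$ is a finite set $V(H)$ of vertices together with a finite multiset $E(H)$ of nonempty subsets of $V(H)$, called edges. A vertex hits an edge if it belongs to that edge; a transversal is a set of vertices having nonempty intersection with every edge. The transversal game on $H$ is played by two players, Edge-hitter and Staller, who take turns choosing a vertex of $H$; each chosen vertex must hit at least one edge not hit by the vertices previously chosen. The game ends when the set of chosen vertices is a transversal of $H$. Edge-hitter wishes to minimize, and Staller wishes to maximize, the total number of vertices chosen. For $S\subseteq E(H)$, $H|S$ denotes the residual hypergraph obtained from $H$ by declaring the edges in $S$ already covered, i.e. deleting the edges in $S$ (and then any isolated vertices, which play no role in the game). $\tau_g(H|S)$ (resp. $\tau_g'(H|S)$) is the number of vertices chosen in the transversal game on $H|S$ under optimal play by both players when Edge-hitter (resp. Staller) has the first turn. *)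

(* Defs.v *)
From mathcomp Require Import all_boot.
From mathcomp Require Import finmap multiset.

Set Implicit Arguments.
Unset Strict Implicit.
Unset Printing Implicit Defensive.

Local Open Scope mset_scope.

(* V(H) is a finite subset of an ambient finite type T, so that deleting       *)
(* vertices stays within one type.                                             *)
Record hypergraph (T : finType) := Hypergraph {
  vertices : {set T};
  edges : {mset {set T}};
  edge_neq0 : forall e : {set T}, e \in edges -> e != set0;
  edge_sub : forall e : {set T}, e \in edges -> e \subset vertices }.

Section Residual.
Variables (T : finType) (H : hypergraph T) (S : {mset {set T}}).

Definition residual_edges : {mset {set T}} := edges H `\` S.

Definition residual_vertices : {set T} :=
  [set v in vertices H | [exists e : {set T}, (e \in residual_edges) && (v \in e)]].

Lemma residual_edge (e : {set T}) : e \in residual_edges -> e \in edges H.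
Proof. by rewrite in_msetB in_mset; apply: leq_ltn_trans. Qed.

Lemma residual_edge_neq0 (e : {set T}) : e \in residual_edges -> e != set0.
Proof. by move/residual_edge/edge_neq0. Qed.

Lemma residual_edge_sub (e : {set T}) :
  e \in residual_edges -> e \subset residual_vertices.
Proof.
move=> He; apply/subsetP => v ve; rewrite inE.
rewrite (subsetP (edge_sub (residual_edge He)) v ve) /=.
by apply/existsP; exists e; rewrite He.
Qed.

Definition residual : hypergraph T :=
  Hypergraph residual_edge_neq0 residual_edge_sub.

End Residual.

Inductive player := EdgeHitter | Staller.

Section TransversalGame.
Variables (T : finType) (H : hypergraph T).

Definition transversal (D : {set T}) : bool :=
  (D \subset vertices H) &&
  [forall e : {set T}, (e \in edges H) ==> (e :&: D != set0)].

(* D is the set of vertices chosen so far. *)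
Definition legal (D : {set T}) (v : T) : bool :=
  (v \in vertices H) &&
  [exists e : {set T}, [&& e \in edges H, v \in e & e :&: D == set0]].

(* Minimax number of further moves, computed to depth n.  A value at depth n   *)
(* is at most n, so the neutral element n of minn never affects a minimum over *)
(* a nonempty set of legal moves.                                              *)
Fixpoint minimax (n : nat) (p : player) (D : {set T}) : nat :=
  if n is n'.+1 then
    if transversal D then 0 else
    match p with
    | EdgeHitter =>
        (\big[minn/n']_(v | legal D v) minimax n' Staller (v |: D)).+1
    | Staller =>
        (\max_(v | legal D v) minimax n' EdgeHitter (v |: D)).+1
    end
  else 0.

(* Every legal move is a vertex not chosen before, so this depth suffices; the *)
(* lemmas below are the resulting depth-free minimax equations.                *)
Definition game_value (p : player) (D : {set T}) : nat :=
  minimax #|vertices H :\: D| p D.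

Definition tau_g : nat := game_value EdgeHitter set0.
Definition tau_g' : nat := game_value Staller set0.

Lemma legal_depth (D : {set T}) v :
  legal D v -> #|vertices H :\: D| = #|vertices H :\: (v |: D)|.+1.
Proof.
case/andP=> Vv /existsP[e /and3P[_ ve /eqP eD0]].
have vD : v \notin D by apply/negP => vD; have := in_set0 v; rewrite -eD0 inE ve vD.
rewrite (cardsD1 v) inE vD Vv /= add1n; congr (_.+1); apply: eq_card => x.
by rewrite !inE negb_or andbA.
Qed.

Lemma legal_ex (D : {set T}) :
  D \subset vertices H -> ~~ transversal D -> exists v, legal D v.
Proof.
move=> DV; rewrite /transversal DV /= negb_forall => /existsP[e].
rewrite negb_imply negbK => /andP[He eD].
have /set0Pn[v ve] := edge_neq0 He; exists v.
rewrite /legal (subsetP (edge_sub He) v ve) /=.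
by apply/existsP; exists e; rewrite He ve.
Qed.

Lemma minimax_le n p D : minimax n p D <= n.
Proof.
elim: n p D => //= n IHn p D; case: ifP => // _; case: p; rewrite ltnS.
  by elim/big_ind: _ => // x y xn yn; rewrite geq_min xn.
by apply/bigmax_leqP.
Qed.

Lemma game_value_transversal p D : transversal D -> game_value p D = 0.
Proof. by rewrite /game_value; case: #|_| => //= n ->. Qed.

Lemma game_value_EdgeHitter (D : {set T}) :
    D \subset vertices H -> ~~ transversal D ->
  (exists2 v, legal D v &
     game_value EdgeHitter D = (game_value Staller (v |: D)).+1) /\
  (forall v, legal D v ->
     game_value EdgeHitter D <= (game_value Staller (v |: D)).+1).
Proof.
move=> DV nT; have [v0 lv0] := legal_ex DV nT.
have E v : legal D v -> #|vertices H :\: (v |: D)| = #|vertices H :\: (v0 |: D)|.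
  by move=> lv; apply: succn_inj; rewrite -!legal_depth.
rewrite /game_value (legal_depth lv0) /= (negbTE nT).
set n := #|vertices H :\: (v0 |: D)|; rewrite -/n in E.
pose F v := minimax n Staller (v |: D).
have le v : legal D v -> \big[minn/n]_(u | legal D u) F u <= F v.
  move=> lv; have := mem_index_enum v; elim: (index_enum T) => // u s IHs.
  rewrite inE big_cons => /predU1P[<-|/IHs Fs]; first by rewrite lv geq_minl.
  by case: ifP => // _; rewrite geq_min Fs orbT.
split; last by move=> v lv; rewrite ltnS E //; apply: le.
case: (arg_minnP F lv0) => v lv vmin; exists v => //; congr (_.+1).
rewrite E //; apply/eqP; rewrite eqn_leq le //=.
elim/big_ind: _ => [|x y vx vy|u /vmin //]; first exact: minimax_le.
by rewrite leq_min vx.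
Qed.

Lemma game_value_Staller (D : {set T}) :
    D \subset vertices H -> ~~ transversal D ->
  (exists2 v, legal D v &
     game_value Staller D = (game_value EdgeHitter (v |: D)).+1) /\
  (forall v, legal D v ->
     (game_value EdgeHitter (v |: D)).+1 <= game_value Staller D).
Proof.
move=> DV nT; have [v0 lv0] := legal_ex DV nT.
have E v : legal D v -> #|vertices H :\: (v |: D)| = #|vertices H :\: (v0 |: D)|.
  by move=> lv; apply: succn_inj; rewrite -!legal_depth.
rewrite /game_value (legal_depth lv0) /= (negbTE nT).
set n := #|vertices H :\: (v0 |: D)|; rewrite -/n in E.
pose F v := minimax n EdgeHitter (v |: D).
have le v : legal D v -> F v <= \max_(u | legal D u) F u.
  by move=> lv; rewrite (bigD1 v) //= leq_maxl.
split; last by move=> v lv; rewrite ltnS E //; apply: le.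
case: (arg_maxnP F lv0) => v lv vmax; exists v => //; congr (_.+1).
rewrite E //; apply/eqP; rewrite eqn_leq le // andbT.
by apply/bigmax_leqP => u /vmax.
Qed.

End TransversalGame.

(* Main.v *)
Require Import Defs.
From mathcomp Require Import all_boot.
From mathcomp Require Import finmap multiset.

(** The future of the game depends only on which edges are still unhit, so
    positions of games on two different hypergraphs can be compared through
    their sets of unhit edges.  When one of these sets is included in the other,
    the position with the smaller set lasts at most as long, whoever is to move
    ([game_value_mono]).

    This goes by induction on the number of vertices not yet chosen in the
    larger position.  If Staller is to move, an optimal move in the smaller
    position is also legal in the larger one, and the inclusion persists after
    it is played in both.  If Edge-hitter is to move, an optimal move [v] of the
    larger position is copied when it is legal in the smaller one.  Otherwise
    [v] meets no unhit edge of the smaller position, so playing [v] in the larger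
    position alone already preserves the inclusion, and any legal move of
    Edge-hitter in the smaller position then preserves it too.  Covering more
    edges before the start leaves fewer edges unhit, whence the theorem. *)

Local Open Scope mset_scope.

Section UnhitEdges.
Variables (T : finType) (H : hypergraph T).

(** A plain set of edges, without multiplicities: parallel edges are hit
    together, so they do not affect which moves are legal. *)
Definition unhit (D : {set T}) : {set {set T}} :=
  [set e | (e \in edges H) && (e :&: D == set0)].

Lemma legalP (D : {set T}) v :
  reflect (exists2 e, e \in unhit D & v \in e) (legal H D v).
Proof.
apply: (iffP andP) => [[_ /existsP[e /and3P[He ve eD]]]|[e]].
  by exists e; rewrite // inE He.
rewrite inE => /andP[He eD] ve; split; first exact: (subsetP (edge_sub He)).
by apply/existsP; exists e; rewrite He ve.
Qed.

Lemma unhitU1 (D : {set T}) v e :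
  (e \in unhit (v |: D)) = (e \in unhit D) && (v \notin e).
Proof.
rewrite !inE setIUr setU_eq0 (setI_eq0 e [set v]) disjoint_sym disjoints1.
by rewrite -andbA; congr (_ && _); apply: andbC.
Qed.

Lemma transversal_unhit (D : {set T}) :
  D \subset vertices H -> Defs.transversal H D = (unhit D == set0).
Proof.
move=> DV; rewrite /Defs.transversal DV /=; apply/forallP/eqP => [hit|none e].
  apply/setP => e; rewrite !inE; apply/negP => /andP[He eD].
  by have := hit e; rewrite He eD.
apply/implyP => He; apply/negP => eD.
by have := in_set0 e; rewrite -none inE He eD.
Qed.

Lemma legal_subset (D : {set T}) v :
  D \subset vertices H -> legal H D v -> v |: D \subset vertices H.
Proof. by move=> DV /andP[Vv _]; rewrite subUset sub1set Vv. Qed.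

End UnhitEdges.

Arguments unhit {T} H D.
Arguments legalP {T H D v}.
Arguments legal_subset {T H D v}.

Lemma unhitU1_mono (T : finType) (G K : hypergraph T) (C D : {set T}) v :
  unhit G C \subset unhit K D -> unhit G (v |: C) \subset unhit K (v |: D).
Proof.
move=> /subsetP sub; apply/subsetP => e.
by rewrite !unhitU1 => /andP[/sub -> ->].
Qed.

(** Edge-hitter can always answer in the smaller position: by copying [v], or, if
    [v] is illegal there, by any legal move, since no unhit edge of the smaller
    position contains [v]. *)
Lemma legal_response {T : finType} {G K : hypergraph T} {C D : {set T}} v :
    C \subset vertices G -> ~~ Defs.transversal G C ->
    unhit G C \subset unhit K D ->
  exists2 u, legal G C u & unhit G (u |: C) \subset unhit K (v |: D).
Proof.
move=> CV nT sub; have [lv|nlv] := boolP (legal G C v).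
  by exists v => //; apply: unhitU1_mono.
have [u lu] := legal_ex CV nT; exists u => //; apply/subsetP => e.
rewrite !unhitU1 => /andP[Ce _]; rewrite (subsetP sub) //=.
by apply: contra nlv => ve; apply/legalP; exists e.
Qed.

(** The two positions have separate sets of chosen vertices because
    Edge-hitter's response may differ from the move being imitated, and separate
    hypergraphs because two residuals of one hypergraph are to be compared. *)
Lemma game_value_mono (T : finType) (G K : hypergraph T) p (C D : {set T}) :
    C \subset vertices G -> D \subset vertices K ->
    unhit G C \subset unhit K D ->
  game_value G p C <= game_value K p D.
Proof.
have [n] := ubnP #|vertices K :\: D|; elim: n => // n IHn in p C D *.
move=> leDn CV DV sub.
have [/game_value_transversal->//|nTC] := boolP (Defs.transversal G C).
have nTD : ~~ Defs.transversal K D.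
  move: nTC; rewrite !transversal_unhit //; apply: contra => /eqP K0.
  by rewrite -subset0 -K0.
have next v : legal K D v -> #|vertices K :\: (v |: D)| < n.
  by move=> /legal_depth depth; rewrite -ltnS -depth.
case: p.
  have [[v lv ->] _] := game_value_EdgeHitter DV nTD.
  have [u lu subuv] := legal_response v CV nTC sub.
  have [_ /(_ u lu) leu] := game_value_EdgeHitter CV nTC.
  apply: leq_trans leu _; rewrite ltnS.
  by apply: IHn => //; [apply: next | apply: legal_subset | apply: legal_subset].
have [[v lv ->] _] := game_value_Staller CV nTC.
have lvK : legal K D v.
  by have /legalP[e Ce ve] := lv; apply/legalP; exists e; rewrite ?(subsetP sub).
have [_ /(_ v lvK)] := game_value_Staller DV nTD.
apply: leq_trans; rewrite ltnS.
by apply: IHn; [apply: next | apply: legal_subset | apply: legal_subset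
  | apply: unhitU1_mono].
Qed.

Lemma residual_edges_anti {T : finType} (H : hypergraph T)
    {A B : {mset {set T}}} (e : {set T}) :
  B `<=` A -> e \in residual_edges H A -> e \in residual_edges H B.
Proof. by rewrite !in_msetB => /msubsetP BA; apply: leq_ltn_trans. Qed.

Theorem lemma3 (T : finType) (H : hypergraph T) (A B : {mset {set T}})
  (hA : A `<=` edges H) (hB : B `<=` edges H) (hBA : B `<=` A) :
  tau_g (residual H A) <= tau_g (residual H B) /\
  tau_g' (residual H A) <= tau_g' (residual H B).
Proof.
have sub : unhit (residual H A) set0 \subset unhit (residual H B) set0.
  apply/subsetP => e; rewrite !inE => /andP[He ->].
  by rewrite andbT; apply: residual_edges_anti He.
by split; apply: game_value_mono; rewrite ?sub0set.
Qed.
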